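(* Let $0\le a<b$ be real numbers, let $\alpha\in(0,1)$, and set $\rho=\frac{1-\alpha}{\alpha}(b-a)$. Let $u:[a,b]\to\mathbb{R}$ be a positive function with $u\in L_1(a,b)$. If $u$ is convex on $[a,b]$, then $$u\left(\frac{a+b}{2}\right)\leq \frac{1-\alpha}{2\left(1-\exp(-\rho)\right)}\left[\mathcal{I}^\alpha_a u(b)+\mathcal{I}^\alpha_b u(a)\right]\leq \frac{u(a)+u(b)}{2}.$$
   Context: For $\alpha\in(0,1)$ and $u\in L_1(a,b)$, the fractional integrals with exponential kernel are defined by $$\mathcal{I}^\alpha_a u(x)=\frac{1}{\alpha}\int_a^x \exp\left(-\frac{1-\alpha}{\alpha}(x-s)\right)u(s)\,ds,\quad x>a,$$ $$\mathcal{I}^\alpha_b u(x)=\frac{1}{\alpha}\int_x^b \exp\left(-\frac{1-\alpha}{\alpha}(s-x)\right)u(s)\,ds,\quad x<b.$$ Thus $\mathcal{I}^\alpha_a u(b)$ is the first operator evaluated at $x=b$, and $\mathcal{I}^\alpha_b u(a)$ is the second evaluated at $x=a$. *)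

(* Defs.v *)
From mathcomp Require Import all_boot all_order all_algebra.
From mathcomp Require Import all_classical all_reals all_analysis.

Set Implicit Arguments.
Unset Strict Implicit.
Unset Printing Implicit Defensive.

Import Order.TTheory GRing.Theory Num.Theory.
Import numFieldNormedType.Exports.

Local Open Scope classical_set_scope.
Local Open Scope ring_scope.

(* Meaningful for a < x (resp. x < b) and u Lebesgue integrable on the interval
   of integration; the values at other arguments are not significant. *)

Definition frac_int_left (R : realType) (alpha a : R) (u : R -> R) (x : R) : R :=
  alpha^-1 * \int[@lebesgue_measure R]_(s in `]a, x[)
    (expR (- ((1 - alpha) / alpha * (x - s))) * u s).

Definition frac_int_right (R : realType) (alpha b : R) (u : R -> R) (x : R) : R :=
  alpha^-1 * \int[@lebesgue_measure R]_(s in `]x, b[)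
    (expR (- ((1 - alpha) / alpha * (s - x))) * u s).

(* Main.v *)
Require Import Defs.
From mathcomp Require Import all_boot all_order all_algebra.
From mathcomp Require Import all_classical all_reals all_analysis.
From mathcomp Require Import measurable_realfun ring lra.

(* Up to a factor, the middle term is the integral of [u] against the weight
   [w s = exp (- k (b - s)) + exp (- k (s - a))] with [k = (1 - alpha) / alpha].
   Since [w] is symmetric about the midpoint [m], every affine function has
   normalised [w]-average equal to its value at [m]. On [a, b] the convex
   function [u] lies above a supporting line at [m] and below the chord joining
   its endpoint values, whose value at [m] is [(u a + u b) / 2]. *)

Set Implicit Arguments.
Unset Strict Implicit.
Unset Printing Implicit Defensive.

Import Order.TTheory GRing.Theory Num.Theory.
Import numFieldNormedType.Exports.

Local Open Scope classical_set_scope.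
Local Open Scope ring_scope.

(** For [x < z], convexity applies at [y = t * x + (1 - t) * z] with [t = (z - y) / (z - x)].
    Multiplying through by [z - x] avoids division, so the degenerate case [x = z] is included. *)
Lemma convex_function_chord (R : realType) (a b : R) (u : R -> R) :
  @convex_function R R^o `[a, b] u ->
  forall x y z : R, a <= x -> x <= y -> y <= z -> z <= b ->
  (z - x) * u y <= (z - y) * u x + (y - x) * u z.
Proof.
move=> cu x y z ax xy yz zb.
have [xz|zx] := ltP x z; last first.
  have -> : y = x by lra.
  have -> : z = x by lra.
  lra.
have zx0 : 0 < z - x by lra.
pose t := (z - y) / (z - x).
have t01 : 0 <= t <= 1.
  by rewrite /t ler_pdivrMr// ler_pdivlMr//; apply/andP; split; lra.
have : u (t * x + (1 - t) * z) <= t * u x + (1 - t) * u z.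
  apply: (cu (Itv01 (andP t01).1 (andP t01).2)); rewrite inE/= in_itv/=; lra.
have -> : t * x + (1 - t) * z = y by rewrite /t; field; lra.
have -> : (z - y) * u x + (y - x) * u z =
    (z - x) * (t * u x + (1 - t) * u z) by rewrite /t; field; lra.
by rewrite ler_pM2l.
Qed.

(** Every difference quotient of [u] to the left of [m] is at most every one to the right, so the
    supremum [c] of the left quotients separates the two families. No differentiability at [m] is
    involved. *)
Lemma convex_function_support (R : realType) (a b m : R) (u : R -> R) :
  @convex_function R R^o `[a, b] u -> a < m < b ->
  exists c : R, forall s, a <= s <= b -> u m + c * (s - m) <= u s.
Proof.
move=> /convex_function_chord cu /andP[am mb].
pose S := [set (u m - u s) / (m - s) | s in `[a, m[%classic].
have Sub s t : a <= s < m -> m < t <= b ->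
    (u m - u s) / (m - s) <= (u t - u m) / (t - m).
  move=> /andP[as_ sm] /andP[mt tb].
  rewrite ler_pdivrMr ?subr_gt0// mulrAC ler_pdivlMr ?subr_gt0//.
  by have := cu s m t as_ (ltW sm) (ltW mt) tb; lra.
have Sb : has_ubound S.
  exists ((u b - u m) / (b - m)) => _ [s /= + <-]; rewrite in_itv/= => sam.
  by apply: Sub => //; rewrite mb lexx.
have S0 : S !=set0.
  by exists ((u m - u a) / (m - a)), a => //=; rewrite in_itv/= lexx am.
exists (sup S) => s /andP[as_ sb].
have [sm|ms|->] := ltgtP s m; last by lra.
- have : (u m - u s) / (m - s) <= sup S.
    by apply: ub_le_sup => //; exists s => //=; rewrite in_itv/= as_ sm.
  rewrite ler_pdivrMr ?subr_gt0//; lra.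
- have : sup S <= (u s - u m) / (s - m).
    apply: ge_sup => // _ [t /= + <-]; rewrite in_itv/= => tam.
    by apply: Sub => //; rewrite ms sb.
  rewrite ler_pdivlMr ?subr_gt0//; lra.
Qed.

Lemma derivable_continuous (R : realType) (f : R -> R) :
  (forall s, derivable f s 1) -> continuous f.
Proof.
by move=> df s; apply: differentiable_continuous; apply/derivable1_diffP.
Qed.

Definition exp_weight (R : realType) (k a b s : R) : R :=
  expR (- (k * (b - s))) + expR (- (k * (s - a))).

Lemma continuous_exp_weight (R : realType) (k a b : R) :
  continuous (exp_weight k a b).
Proof.
by rewrite /exp_weight; apply: derivable_continuous => s.
Qed.

(** An explicit antiderivative gives the value. The slope [c] drops out: its contributions at [a]
    and [b] cancel because the affine factor is centred at the midpoint. *)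
Lemma Rintegral_exp_weight_affine (R : realType) (k a b A c : R) :
  0 < k -> a < b ->
  \int[@lebesgue_measure R]_(s in `]a, b[)
    (exp_weight k a b s * (A + c * (s - (a + b) / 2))) =
  2 * A * (1 - expR (- (k * (b - a)))) / k.
Proof.
move=> k0 ab.
pose L (s : R) := A + c * (s - (a + b) / 2).
pose f s := exp_weight k a b s * L s.
(* Integration by parts of each exponential against [L], whose derivative is [c]; the opposite signs
   of the exponents give the opposite signs of [c / k ^+ 2]. *)
pose F (s : R) := expR (- (k * (b - s))) * (L s / k - c / k ^+ 2)
  - expR (- (k * (s - a))) * (L s / k + c / k ^+ 2).
have dF (s : R) : is_derive s (1 : R) F (f s).
  rewrite /F /f /exp_weight /L; apply: is_derive_eq.
  rewrite /GRing.scale/=; field; lra.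
have cF : continuous F by apply: derivable_continuous.
have cf : continuous f.
  move=> s; apply: cvgM; first exact: continuous_exp_weight.
  by move: s; rewrite /L; apply: derivable_continuous => s.
have /measurable_EFinP mf : measurable_fun (`]a, b[ : set R) f.
  apply: measurable_funTS.
  exact: continuous_measurable_fun.
transitivity (fine (\int[@lebesgue_measure R]_(s in `[a, b]) (f s)%:E)%E).
  (* The endpoints form a null set, so the interval may be closed before the fundamental theorem of
     calculus is applied. *)
  by congr fine; rewrite (integral_itv_bndoo true false mf).
rewrite (@continuous_FTC2 _ f F)//=; first last.
- by move=> s _; rewrite derive1E; apply: derive_val.
- split=> [s _||].
  + exact: ex_derive.
  + by apply: cvg_at_right_filter; exact: cF.
  + by apply: cvg_at_left_filter; exact: cF.
- exact: continuous_subspaceT.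
rewrite /F /L !subrr mulr0 oppr0 expR0; field; lra.
Qed.

Lemma continuous_integrable_oo (R : realType) (a b : R) (f : R -> R) :
  continuous f ->
  (@lebesgue_measure R).-integrable `]a, b[ (fun s => (f s)%:E).
Proof.
move=> cf; have cptab : compact (`[a, b]%classic : set R).
  exact: segment_compact.
have := continuous_compact_integrable cptab (continuous_subspaceT cf).
by apply: integrableS => //; exact: subset_itv_oo_cc.
Qed.

(** The factor [h] is bounded on the open interval because its image of the compact [[a, b]] is
    bounded. *)
Lemma integrable_continuousM (R : realType) (a b : R) (h g : R -> R) :
  continuous h ->
  (@lebesgue_measure R).-integrable `]a, b[ (EFin \o g) ->
  (@lebesgue_measure R).-integrable `]a, b[ (fun s => (h s * g s)%:E).
Proof.
move=> ch ig.
have mh : measurable_fun `]a, b[ h.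
  by apply: measurable_funTS; exact: continuous_measurable_fun.
rewrite [X in integrable _ _ X](_ : _ = (EFin \o h) \* (EFin \o g))%E//.
apply: integrableMr => //.
have /compact_bounded[M [Mr hM]] : compact (h @` `[a, b]).
  apply: continuous_compact; last exact: segment_compact.
  exact: continuous_subspaceT.
exists M; split=> // x Mx y; rewrite /= in_itv/= => /andP[ay yb].
by apply: (hM x Mx); exists y => //=; rewrite in_itv/= !ltW.
Qed.

Theorem theorem3p1 (R : realType) (a b alpha : R) (u : R -> R)
    (ha : 0 <= a) (hab : a < b)
    (halpha0 : 0 < alpha) (halpha1 : alpha < 1)
    (upos : forall x : R, a <= x <= b -> 0 < u x)
    (uL1 : (@lebesgue_measure R).-integrable `]a, b[ (EFin \o u))
    (uconvex : @convex_function R R^o `[a, b] u) :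
  let rho := (1 - alpha) / alpha * (b - a) in
  let M := (1 - alpha) / (2 * (1 - expR (- rho))) *
           (frac_int_left alpha a u b + frac_int_right alpha b u a) in
  u ((a + b) / 2) <= M /\ M <= (u a + u b) / 2.
Proof.
move=> rho M.
pose k := (1 - alpha) / alpha.
have k0 : 0 < k by rewrite divr_gt0//; lra.
have E1 : 0 < 1 - expR (- rho).
  by rewrite subr_gt0 expR_lt1 oppr_lt0 mulr_gt0// subr_gt0.
pose I (g : R -> R) :=
  \int[@lebesgue_measure R]_(s in `]a, b[) (exp_weight k a b s * g s).
have intw g : (@lebesgue_measure R).-integrable `]a, b[ (EFin \o g) ->
    (@lebesgue_measure R).-integrable `]a, b[
      (fun s => (exp_weight k a b s * g s)%:E).
  by apply: integrable_continuousM; exact: continuous_exp_weight.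
have inta A c : (@lebesgue_measure R).-integrable `]a, b[
    (fun s => (A + c * (s - (a + b) / 2))%:E).
  by apply: continuous_integrable_oo; apply: derivable_continuous => s.
(* Both fractional integrals run over the same interval []a, b[], so their kernels add up to
   [exp_weight]; the factor [alpha^-1] turns [1 - alpha] into [k]. *)
have ME : M = k / (2 * (1 - expR (- rho))) * I u.
  rewrite /M /frac_int_left /frac_int_right -mulrDr -RintegralD//; first last.
  - by apply: integrable_continuousM => //; apply: derivable_continuous => s.
  - by apply: integrable_continuousM => //; apply: derivable_continuous => s.
  rewrite /I /exp_weight; under [in RHS]eq_Rintegral do rewrite mulrDl.
  rewrite -/k /k; field; lra.
have Iaff A c :
    k / (2 * (1 - expR (- rho))) * I (fun s => A + c * (s - (a + b) / 2)) = A.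
  rewrite /I Rintegral_exp_weight_affine// -/rho; field; lra.
have w0 s : 0 <= exp_weight k a b s by rewrite addr_ge0// expR_ge0.
have Ile f g : (@lebesgue_measure R).-integrable `]a, b[ (EFin \o f) ->
    (@lebesgue_measure R).-integrable `]a, b[ (EFin \o g) ->
    (forall s, a <= s <= b -> f s <= g s) ->
    k / (2 * (1 - expR (- rho))) * I f <= k / (2 * (1 - expR (- rho))) * I g.
  move=> fi gi fg; rewrite ler_pM2l; last by rewrite divr_gt0// mulr_gt0.
  apply: le_Rintegral => //; [exact: intw|exact: intw|].
  move=> s; rewrite /= in_itv/= => /andP[sa sb].
  by apply: ler_wpM2l => //; apply: fg; rewrite !ltW.
rewrite ME; split.
- have [|c hc] := @convex_function_support R a b ((a + b) / 2) u uconvex.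
    by apply/andP; split; lra.
  (* The value at the midpoint becomes the normalised average of the supporting line. *)
  rewrite -[leLHS](Iaff _ c); apply: Ile => //; exact: inta.
(* The chord from [a] to [b], expanded about the midpoint: value [(u a + u b) / 2], slope
   [(u b - u a) / (b - a)]. *)
- rewrite -[leRHS](Iaff _ ((u b - u a) / (b - a))).
  apply: Ile => [//| |s /andP[as_ sb]]; first exact: inta.
  have ba0 : 0 < b - a by lra.
  rewrite -(ler_pM2l ba0).
  apply: (le_trans (convex_function_chord uconvex (lexx a) as_ sb (lexx b))).
  (* The two sides are equal: both are [b - a] times the chord at [s]. *)
  by rewrite le_eqVlt; apply/orP; left; apply/eqP; field; lra.
Qed.
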